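(* There exist constants $c_1,c_2>0$, not depending on $\alpha$, $n$ or $M$, such that the following holds. Let $n\in\mathbb N^\star$, let $\alpha\in(0,22/35]$, and let $M$ be a probability distribution on $\mathbb N^\star$ with $\mathbb E_{m\sim M}[m]<\infty$. Then for every $a\in\mathbb N=\{0,1,2,\dots\}$, $$R_{\alpha,n,M}\;\ge\;\frac{c_1\exp\!\big(-c_2\,n\alpha^2\,\mathbb P_{m\sim M}(m>a)^2\big)}{\big(n\alpha^2\,\mathbb E_{m\sim M}[\sqrt m\,\mathbb 1\{m\le a\}]^2\big)\vee 1}.$$
   Context: Setting (user-level local differential privacy). $\mathbb N^\star=\{1,2,\dots\}$; $M$ is a known probability distribution on $\mathbb N^\star$. Let $\mathcal X=\bigcup_{k\ge1}[-1,1]^k$. For a probability distribution $\mu$ on $[-1,1]$ with mean $\theta_\mu=\mathbb E_{X\sim\mu}[X]$, let $\nu_\mu$ be the law on $\mathcal X$ of a random vector obtained by drawing $m\sim M$ and then, conditionally on $m=i$, drawing $(X_1,\dots,X_i)\sim\mu^{\otimes i}$. There are $n$ users; user $u\in[n]$ holds $X^{(u)}$, and $X^{(1)},\dots,X^{(n)}$ are i.i.d. with law $\nu_\mu$ (the sizes $m_u$ are not revealed). A mechanism $Q=(Q_u)_{u\in[n]}$ is a family of Markov kernels $Q_u(\cdot\mid x,z_{1:u-1})$ from $\mathcal X\times\mathcal Z^{u-1}$ to a measurable space $(\mathcal Z,\mathfrak Z)$; the released views are generated sequentially, $Z^{(u)}\sim Q_u(\cdot\mid X^{(u)},Z^{(1:u-1)})$.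 $Q$ is $\alpha$-LDP if for all $u\in[n]$, all $z_{1:u-1}\in\mathcal Z^{u-1}$, all $x,x'\in\mathcal X$ and all $S\in\mathfrak Z$, $Q_u(S\mid x,z_{1:u-1})\le e^{\alpha}Q_u(S\mid x',z_{1:u-1})$; $\mathcal Q_\alpha$ denotes the set of $\alpha$-LDP mechanisms. An estimator is a measurable map $\hat\theta:\mathcal Z^n\to[-1,1]$. With $\mathcal D$ the set of all probability distributions on $[-1,1]$, the minimax risk is $$R_{\alpha,n,M}=\inf_{Q\in\mathcal Q_\alpha,\ \hat\theta}\ \sup_{\mu\in\mathcal D}\ \mathbb E\big[|\hat\theta(Z^{(1:n)})-\theta_\mu|^2\big].$$ $a\vee b=\max(a,b)$. *)

(* Defs.v *)
From HB Require Import structures.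
From mathcomp Require Import all_boot all_order all_algebra.
From mathcomp Require Import all_classical all_reals all_analysis measurable_realfun.
Set Implicit Arguments. Unset Strict Implicit. Unset Printing Implicit Defensive.
Import Order.TTheory GRing.Theory Num.Theory.
Import numFieldNormedType.Exports.
Local Open Scope classical_set_scope.
Local Open Scope ring_scope.

Section user_ldp.
Context {R : realType}.

Definition is_distrib_Nstar (Mp : nat -> R) : Prop :=
  [/\ forall m, 0 <= Mp m, Mp 0%N = 0 & (\sum_(m <oo) (Mp m)%:E = 1)%E].

Definition finite_mean (Mp : nat -> R) : Prop :=
  (\sum_(m <oo) (m%:R * Mp m)%:E < +oo)%E.

Definition tailM (Mp : nat -> R) (a : nat) : R :=
  fine (\sum_(a.+1 <= m <oo) (Mp m)%:E)%E.

Definition sqrt_trunc_mean (Mp : nat -> R) (a : nat) : R :=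
  \sum_(1 <= m < a.+1) Num.sqrt (m%:R) * Mp m.

(* The data space X = U_{k>=1} [-1,1]^k, as non-empty sequences in [-1,1]. *)
Definition in_X (x : seq R) : Prop :=
  (0 < size x)%N /\ forall r, r \in x -> -1 <= r <= 1.

Definition mean_of (mu : probability R R) : R := fine (\int[mu]_x (x%:E))%E.

Definition supported_in_unit (mu : probability R R) : Prop :=
  mu `[-1, 1]%classic = 1%E.

(* iterated integral w.r.t. mu^{(x) k} of g (arguments x_1, ..., x_k) *)
Fixpoint iter_int (mu : probability R R) (k : nat) (g : seq R -> \bar R)
  : \bar R :=
  match k with
  | 0%N => g [::]
  | k'.+1 => (\int[mu]_x iter_int mu k' (fun s => g (x :: s)))%E
  end.

(* integral of g w.r.t. nu_mu : draw m ~ M, then (X_1..X_m) ~ mu^{(x) m} *)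
Definition nu_int (Mp : nat -> R) (mu : probability R R) (g : seq R -> \bar R)
  : \bar R :=
  (\sum_(k <oo) (Mp k)%:E * iter_int mu k g)%E.

Context {d : measure_display} {Z : measurableType d}.

(* A mechanism: Q x zs is the law Q_u( . | x, z_{1:u-1}) of the view of
   user u = size zs + 1, given its data x and the previous views zs. *)
Definition mechanism := seq R -> seq Z -> probability Z R.

(* Markov-kernel measurability: for each user u <= n (u-1 = size of zs) and
   data size k >= 1, (x, z_{1:u-1}) |-> Q_u(S | x, z_{1:u-1}) is measurable on
   [-1,1]^k x Z^{u-1} (product sigma-algebra). *)
Definition is_markov_mech (n : nat) (Q : mechanism) : Prop :=
  forall (k u : nat) (S : set Z), (0 < k)%N -> (u < n)%N -> measurable S ->
    measurable_fun
      [set p : k.-tuple R * u.-tuple Z | forall i, -1 <= tnth p.1 i <= 1]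
      (fun p : k.-tuple R * u.-tuple Z => (Q (tval p.1) (tval p.2) S : \bar R)).

Definition is_LDP (n : nat) (alpha : R) (Q : mechanism) : Prop :=
  forall (zs : seq Z) (x x' : seq R) (S : set Z),
    (size zs < n)%N -> in_X x -> in_X x' -> measurable S ->
    (Q x zs S <= (expR alpha)%:E * Q x' zs S)%E.

(* An estimator: a measurable map Z^n -> [-1,1] (its values on sequences of
   length <> n are irrelevant). *)
Definition is_estimator (n : nat) (th : seq Z -> R) : Prop :=
  measurable_fun [set: n.-tuple Z] (fun t : n.-tuple Z => th (tval t)) /\
  forall t : n.-tuple Z, -1 <= th (tval t) <= 1.

(* E[ f(Z^{(1:n)}) ] under the sequential generation of the views; the
   remaining users are r, the views already released are zs. *)
Fixpoint seq_expect (Mp : nat -> R) (mu : probability R R) (Q : mechanism)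
  (f : seq Z -> \bar R) (r : nat) (zs : seq Z) : \bar R :=
  match r with
  | 0%N => f zs
  | r'.+1 => nu_int Mp mu
      (fun x => \int[Q x zs]_z seq_expect Mp mu Q f r' (rcons zs z))%E
  end.

Definition risk (n : nat) (Mp : nat -> R) (Q : mechanism) (th : seq Z -> R)
  (mu : probability R R) : \bar R :=
  seq_expect Mp mu Q (fun zs => ((th zs - mean_of mu) ^+ 2)%:E) n [::].

Definition worst_risk (n : nat) (Mp : nat -> R) (Q : mechanism)
  (th : seq Z -> R) : \bar R :=
  ereal_sup [set risk n Mp Q th mu | mu in supported_in_unit].

End user_ldp.

(* Main.v *)
Require Import Defs.
From HB Require Import structures.
From mathcomp Require Import all_boot all_order all_algebra.
From mathcomp Require Import all_classical all_reals all_analysis measurable_realfun.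
From mathcomp Require Import ring lra.
Set Implicit Arguments. Unset Strict Implicit. Unset Printing Implicit Defensive.
Import Order.TTheory GRing.Theory Num.Theory.
Import numFieldNormedType.Exports.
Local Open Scope classical_set_scope.
Local Open Scope ring_scope.

(** Two-point method with the laws of signs of mean 0 and dl, where
    dl^2 = 1 / (n alpha^2 E[sqrt m; m <= a]^2 \/ 1). The data are then discrete,
    and the L1 distance between the two laws of a user's data is at most
    T = 3 dl E[sqrt m; m <= a] + 2 P(m > a). By local privacy, whatever the past
    views, the two laws P0, P1 of the next view satisfy |P1 - P0| <= eps P0 with
    eps of order alpha T. If f g >= lam on the space of views, then
    (int f dP0) (int g dP1) >= lam exp(-4 eps^2); applied to the conditional
    risks shifted by t > 0 and iterated over the n users, this bounds the product
    of the two shifted risks below by t (dl^2 / 4) exp(-4 n eps^2), and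
    t = dl^2 exp(-4 n eps^2) / 16 shows that one of the risks is at least t. *)

(** * Expectations over i.i.d. signs, and the L1 distance between fair and biased signs *)

Section sign_sums.
Context {R : realType}.
Implicit Types (p q c dl : R) (g h : seq R -> R) (s : seq R) (k : nat).

(** When p + q = 1, this is the expectation of [g] under k i.i.d. signs, written as a finite sum
    with the recursion of [iter_int]. *)
Fixpoint sign_sum p q k g : R :=
  if k is k'.+1 then
    p * sign_sum p q k' (fun s => g (1 :: s)) +
    q * sign_sum p q k' (fun s => g (-1 :: s))
  else g [::].

Definition signs k s := size s = k /\ forall r, r \in s -> r = 1 \/ r = -1.

Lemma signs_nil : signs 0 [::].
Proof. by split. Qed.

Lemma signs_cons1 k s : signs k s -> signs k.+1 (1 :: s).
Proof.
move=> [sk sP]; split=> [/=|r]; first by rewrite sk.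
by rewrite inE => /orP[/eqP->|/sP//]; left.
Qed.

Lemma signs_consN1 k s : signs k s -> signs k.+1 (-1 :: s).
Proof.
move=> [sk sP]; split=> [/=|r]; first by rewrite sk.
by rewrite inE => /orP[/eqP->|/sP//]; right.
Qed.

Lemma signs_in_X k s : (0 < k)%N -> signs k s -> in_X s.
Proof. by move=> k0 [sk sP]; split=> [|r /sP[]->]; [rewrite sk|lra|lra]. Qed.

Lemma eq_sign_sum p q k g h : (forall s, signs k s -> g s = h s) ->
  sign_sum p q k g = sign_sum p q k h.
Proof.
elim: k g h => [|k IH] g h gh /=; first exact/gh/signs_nil.
by congr (_ * _ + _ * _); apply: IH => s /[dup] /signs_cons1 ? /signs_consN1 ?;
  exact: gh.
Qed.

Lemma sign_sumD p q k g h : sign_sum p q k (fun s => g s + h s) =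
  sign_sum p q k g + sign_sum p q k h.
Proof. by elim: k g h => //= k IH g h; rewrite !IH; ring. Qed.

Lemma sign_sumZ p q k c g : sign_sum p q k (fun s => c * g s) =
  c * sign_sum p q k g.
Proof. by elim: k g => //= k IH g; rewrite !IH; ring. Qed.

Lemma sign_sum_cst p q k c : p + q = 1 -> sign_sum p q k (fun=> c) = c.
Proof. by move=> pq; elim: k => //= k ->; rewrite -mulrDl pq mul1r. Qed.

Lemma le_sign_sum p q k g h : 0 <= p -> 0 <= q ->
  (forall s, signs k s -> g s <= h s) ->
  sign_sum p q k g <= sign_sum p q k h.
Proof.
move=> p0 q0; elim: k g h => [|k IH] g h gh /=; first exact/gh/signs_nil.
by apply: lerD; apply: ler_wpM2l => //; apply: IH => s
  /[dup] /signs_cons1 ? /signs_consN1 ?; exact: gh.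
Qed.

Lemma ler_norm_sign_sum p q k g : 0 <= p -> 0 <= q ->
  `|sign_sum p q k g| <= sign_sum p q k (fun s => `|g s|).
Proof.
move=> p0 q0; elim: k g => //= k IH g; rewrite (le_trans (ler_normD _ _))//.
by rewrite !normrM (ger0_norm p0) (ger0_norm q0) lerD// ler_wpM2l.
Qed.

(* The density of the law of k i.i.d. signs of mean dl with respect to that of
   k fair signs. *)
Definition sign_density dl s : R := \prod_(r <- s) (1 + dl * r).

(** At r = 1 and r = -1, the weight (1 + dl r) / 2 is the fair weight 1/2 times one factor of the
    density. *)
Lemma sign_sum_density dl k g :
  sign_sum ((1 + dl) / 2) ((1 - dl) / 2) k g =
  sign_sum 2^-1 2^-1 k (fun s => g s * sign_density dl s).
Proof.
elim: k g => [|k IH] g /=; first by rewrite /sign_density big_nil mulr1.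
rewrite !IH -!sign_sumZ; congr (_ + _); apply: eq_sign_sum => s _;
  by rewrite /sign_density big_cons; field.
Qed.

Lemma sign_density_ge0 dl k s : 0 <= dl <= 1 -> signs k s ->
  0 <= sign_density dl s.
Proof.
move=> dl01 [_ sP]; rewrite /sign_density big_seq; apply: prodr_ge0 => r /sP.
by case=> ->; lra.
Qed.

Lemma sign_sum_density1 dl k : sign_sum 2^-1 2^-1 k (sign_density dl) = 1.
Proof.
transitivity (sign_sum ((1 + dl) / 2) ((1 - dl) / 2) k (fun=> 1)).
  2: by rewrite sign_sum_cst//; field.
by rewrite sign_sum_density; apply: eq_sign_sum => s _; rewrite mul1r.
Qed.

(** The chi-square computation: the second moment factorises over the coordinates, and a fair sign r
    gives (1 + dl r)^2 the mean 1 + dl^2. *)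
Lemma sign_sum_density_sqr dl k :
  sign_sum 2^-1 2^-1 k (fun s => sign_density dl s ^+ 2) = (1 + dl ^+ 2) ^+ k.
Proof.
elim: k => [|k IH] /=; first by rewrite /sign_density big_nil expr1n.
have E r : sign_sum 2^-1 2^-1 k (fun s => sign_density dl (r :: s) ^+ 2) =
    (1 + dl * r) ^+ 2 * (1 + dl ^+ 2) ^+ k.
  rewrite -IH -sign_sumZ; apply: eq_sign_sum => s _.
  by rewrite /sign_density big_cons exprMn.
by rewrite !E [RHS]exprS; field.
Qed.

(** Since the density W is nonnegative, |W - 1| <= W + 1, and W has mean 1. *)
Lemma sign_sum_density_dist2 dl k : 0 <= dl <= 1 ->
  sign_sum 2^-1 2^-1 k (fun s => `|sign_density dl s - 1|) <= 2.
Proof.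
move=> dl01.
have h2 : sign_sum 2^-1 2^-1 k (fun s => sign_density dl s + 1) = 2.
  by rewrite sign_sumD sign_sum_density1 sign_sum_cst//; field.
rewrite -[leRHS]h2; apply: le_sign_sum => // s /(sign_density_ge0 dl01) s0.
by rewrite ler_norml; lra.
Qed.

(** From (1 - y) exp(y) <= 1, because the last hypothesis gives (1 - y)(1 + c y) >= 1. *)
Lemma expR_le1D y c : 0 < c -> 0 <= y -> y * c <= c - 1 -> expR y <= 1 + c * y :> R.
Proof.
move=> c0 y0 yc.
have e0 := expR_gt0 y.
have h : (1 - y) * expR y <= 1.
  rewrite -ler_pdivlMr// div1r -expRN.
  by have := @expR_ge1Dx R (- y); lra.
have y1 : 0 < 1 - y by rewrite -(pmulr_rgt0 _ c0); lra.
rewrite -(ler_pM2l y1) (le_trans h)//; nra.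
Qed.

Lemma expn1D_le x k : 0 <= x -> k%:R * x <= 2^-1 ->
  (1 + x) ^+ k <= 1 + 2 * (k%:R * x) :> R.
Proof.
move=> x0 kx1; apply: (@le_trans _ _ (expR (k%:R * x))).
  by rewrite mulrC expRM_natr lerXn2r ?nnegrE ?expR_ge0 ?expR_ge1Dx//; lra.
by apply: expR_le1D => //; [rewrite mulr_ge0|lra].
Qed.

(** The chi-square divergence (1 + dl^2)^k - 1 is at most 2 t^2 for small t = dl sqrt k, and it
    controls the L1 distance. *)
Lemma sign_sum_density_dist dl k : 0 <= dl <= 1 ->
  sign_sum 2^-1 2^-1 k (fun s => `|sign_density dl s - 1|) <=
  3 * (dl * Num.sqrt k%:R).
Proof.
move=> dl01; set t := dl * Num.sqrt k%:R.
have t0 : 0 <= t by rewrite mulr_ge0 ?sqrtr_ge0//; lra.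
have t2 : t ^+ 2 = k%:R * dl ^+ 2 by rewrite exprMn sqr_sqrtr// mulrC.
(* From 2/3 on, the trivial bound 2 is at most 3 t; below it, t^2 < 4/9 meets the condition t^2 <=
   1/2 of [expn1D_le]. *)
have [t1|t1] := lerP (2 / 3) t.
  by rewrite (le_trans (sign_sum_density_dist2 k dl01))//; lra.
(* The AM-GM step below divides by t. If t = 0, then dl = 0 or k = 0, and the density is 1. *)
have [t_eq0|tneq0] := eqVneq t 0.
  move: t_eq0 => /eqP; rewrite mulf_eq0 => /orP[/eqP d0|].
    rewrite (@eq_sign_sum _ _ _ _ (fun=> 0)); first by rewrite sign_sum_cst; lra.
    move=> s _; rewrite /sign_density big1 ?subrr ?normr0// => r _.
    by rewrite d0 mul0r addr0.
  rewrite sqrtr_eq0 => k0; have {}k0 : k = 0%N by case: k k0 {t t0 t2 t1} => // k; rewrite lern0.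
  by rewrite [X in sign_sum _ _ X _]k0 /= /sign_density big_nil subrr normr0; lra.
have tp : 0 < t by rewrite lt0r tneq0.
(* AM-GM: |W - 1| <= ((W - 1)^2 / t + t) / 2. *)
have : sign_sum 2^-1 2^-1 k (fun s => `|sign_density dl s - 1|) <=
   sign_sum 2^-1 2^-1 k (fun s => (2 * t)^-1 * sign_density dl s ^+ 2 +
     ((- t^-1) * sign_density dl s + ((2 * t)^-1 + t / 2))).
  apply: le_sign_sum => // s _; set W := sign_density dl s.
  have -> : (2 * t)^-1 * W ^+ 2 + (- t^-1 * W + ((2 * t)^-1 + t / 2)) =
     `|W - 1| + (`|W - 1| - t) ^+ 2 / (2 * t).
    have -> : (`|W - 1| - t) ^+ 2 = (W - 1) ^+ 2 - 2 * t * `|W - 1| + t ^+ 2.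
      by rewrite -[X in _ = X - _ + _]real_normK ?num_real//; ring.
    by field; lra.
  by rewrite lerDl divr_ge0 ?sqr_ge0//; lra.
move=> /le_trans; apply.
rewrite sign_sumD sign_sumZ sign_sum_density_sqr.
rewrite sign_sumD sign_sumZ sign_sum_density1.
rewrite sign_sum_cst; last by field.
have := @expn1D_le (dl ^+ 2) k (sqr_ge0 _).
rewrite -t2 => /(_ _)/wrap[]; first by nra.
set A := (1 + _) ^+ k => hA.
have -> : (2 * t)^-1 * A + (- t^-1 * 1 + ((2 * t)^-1 + t / 2)) =
   (A - 1) / (2 * t) + t / 2 by field; lra.
have : (A - 1) / (2 * t) <= t.
  by rewrite ler_pdivrMr; lra.
lra.
Qed.

(** Both laws have mass one, so [g] can be recentred at [g0] before it is summed against the density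
    minus 1. Hence only the oscillation of [g] counts, which privacy makes small. *)
Lemma sign_sum_dist dl k g (g0 : R) c : 0 <= dl <= 1 -> 0 <= c ->
  (forall s, signs k s -> `|g s - g0| <= c) ->
  `|sign_sum ((1 + dl) / 2) ((1 - dl) / 2) k g - sign_sum 2^-1 2^-1 k g| <=
  c * sign_sum 2^-1 2^-1 k (fun s => `|sign_density dl s - 1|).
Proof.
move=> dl01 c0 gc.
have -> : sign_sum ((1 + dl) / 2) ((1 - dl) / 2) k g - sign_sum 2^-1 2^-1 k g =
   sign_sum 2^-1 2^-1 k (fun s => (g s - g0) * (sign_density dl s - 1)).
  rewrite sign_sum_density.
  rewrite [RHS](@eq_sign_sum _ _ _ _ (fun s => g s * sign_density dl s +
     (-1 * g s + ((- g0) * sign_density dl s + g0)))); last by move=> s _; ring.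
  rewrite !sign_sumD !sign_sumZ sign_sum_density1 sign_sum_cst; last by field.
  by ring.
rewrite (le_trans (ler_norm_sign_sum _ _ _ _))// -sign_sumZ.
apply: le_sign_sum => // s ks; rewrite normrM ler_wpM2r//; exact: gc.
Qed.

End sign_sums.

(** * Comparison of integrals under two nearby laws, and the one-user affinity bound *)

Section change_of_measure.
Context {R : realType} {d : measure_display} {Z : measurableType d}.
Implicit Types (P Q : {measure set Z -> \bar R}) (f g h u v : Z -> R).

Lemma bounded_integrable P h (C : R) : (P setT < +oo)%E ->
  measurable_fun setT h -> (forall z, `|h z| <= C) ->
  P.-integrable setT (EFin \o h).
Proof.
move=> Pfin mh hC; apply: measurable_bounded_integrable => //.
exists C; split; first exact: num_real.
by move=> x Cx z _ /=; exact: le_trans (hC z) (ltW Cx).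
Qed.

Lemma le_measure_Rintegral P1 P2 P3 (eps : R) h (C : R) :
  (P1 setT < +oo)%E -> (P2 setT < +oo)%E -> (P3 setT < +oo)%E -> 0 <= eps ->
  (forall S, measurable S -> P1 S <= P2 S + eps%:E * P3 S)%E ->
  measurable_fun setT h -> (forall z, 0 <= h z <= C) ->
  \int[P1]_z h z <= \int[P2]_z h z + eps * \int[P3]_z h z.
Proof.
move=> P1fin P2fin P3fin e0 P123 mh hC.
have hC' z : `|h z| <= C by case/andP: (hC z) => h0 ?; rewrite ger0_norm.
have fin P : (P setT < +oo)%E -> (\int[P]_z (h z)%:E)%E \is a fin_num.
  by move=> Pfin; apply: integrable_fin_num => //; exact: bounded_integrable hC'.
have h0 z : setT z -> (0 <= (h z)%:E)%E.
  by move=> _; case/andP: (hC z) => h0 _; rewrite lee_fin.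
have mh' : measurable_fun setT (EFin \o h) by exact/measurable_EFinP.
rewrite -lee_fin EFinD EFinM /Rintegral !fineK ?fin//.
have := @ge0_le_measure_integral _ _ _ P1
  (measure_add P2 (mscale (NngNum e0) P3)) _ (EFin \o h) setT measurableT.
rewrite ge0_integral_measure_add// ge0_integral_mscale//; apply.
- move=> S mS; rewrite [leRHS]measure_addE; exact: P123.
- by move=> z; exact: h0.
- by [].
Qed.

Lemma addr_maxB0 (x a : R) : x + Num.max (a - x) 0 = a + Num.max (x - a) 0.
Proof. by have [?|?] := leP (x - a) 0; have [?|?] := leP (a - x) 0; lra. Qed.

Lemma maxB0_norm (x a : R) : Num.max (x - a) 0 + Num.max (a - x) 0 = `|x - a|.
Proof.
by have [?|?] := leP (x - a) 0; have [?|?] := leP (a - x) 0;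
  have [?|?] := ger0P (x - a); lra.
Qed.

(** In the application, a and G are the means of g under P and P', and (1 + y) / a is the P-mean of
    1/g, so y is the Jensen excess. For eps > 1/2 the bound a <= e G is used, for y >= 1 the bound
    (1 - eps) a <= G, and otherwise the second-order bound. *)
Lemma affinity_step_real (eps a y G : R) : 0 <= eps -> 0 < a -> 0 <= y ->
  a * (1 - y / 2 - eps ^+ 2 / 2) <= G -> (1 - eps) * a <= G ->
  a <= expR 1 * G -> expR (- (4 * eps ^+ 2)) <= (1 + y) / a * G.
Proof.
move=> e0 a0 y0 GA Ge GE; rewrite mulrAC ler_pdivlMr//.
have x0 : 0 <= eps ^+ 2 by rewrite sqr_ge0.
have [e12|e12] := leP eps 2^-1; last first.
  have : expR (- (4 * eps ^+ 2)) <= expR (-1) :> R by rewrite ler_expR; nra.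
  have EE : expR (-1) * expR 1 = 1 :> R by rewrite -expRD addNr expR0.
  have E0 := @expR_gt0 R (-1).
  have G0 : 0 <= G by nra.
  move=> h; have : expR (- (4 * eps ^+ 2)) * a <= expR (-1) * (expR 1 * G).
    by apply: ler_pM => //; exact: ltW.
  by rewrite mulrA EE mul1r => /le_trans; apply; nra.
have e22 : eps ^+ 2 <= 4^-1 by nra.
have [y1|y1] := leP 1 y.
  have : expR (- (4 * eps ^+ 2)) <= 1 :> R by rewrite expR_le1; lra.
  have G2 : a / 2 <= G by nra.
  move=> h; apply: (@le_trans _ _ a); first by apply: ler_piMl => //; exact: ltW.
  by nra.
(* With x = eps^2 <= 1/4, exp(-4x) <= 1 / (1 + 4x) <= 1 - x. *)
have ex : expR (- (4 * eps ^+ 2)) <= 1 - eps ^+ 2.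
  have e4 := @expR_ge1Dx R (4 * eps ^+ 2).
  rewrite expRN -[leLHS]mul1r ler_pdivrMr ?expR_gt0//; nra.
apply: (@le_trans _ _ ((1 + y) * (a * (1 - y / 2 - eps ^+ 2 / 2)))).
  apply: (le_trans (ler_wpM2r (ltW a0) ex)).
  rewrite [leRHS]mulrCA [leLHS]mulrC; apply: ler_wpM2l; first exact: ltW.
  (* This product is twice the difference of the two sides. *)
  have : 0 <= (y + eps ^+ 2) * (1 - y) by rewrite mulr_ge0//; lra.
  lra.
by rewrite ler_wpM2l//; lra.
Qed.

(* The lower bound on the affinity of two laws with a likelihood ratio within
   eps of 1, without densities: expand 1/g to second order around the mean a
   of g and absorb the first-order error eps * |g - a| by AM-GM. *)
Lemma affinity_step P P' (eps lam c C : R) f g :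
  P setT = 1%E -> P' setT = 1%E -> 0 <= eps -> 0 <= lam -> 0 < c ->
  (forall S, measurable S -> P S <= P' S + eps%:E * P S)%E ->
  (forall S, measurable S -> P' S <= P S + eps%:E * P S)%E ->
  (forall S, measurable S -> P S <= (expR 1)%:E * P' S)%E ->
  measurable_fun setT f -> measurable_fun setT g ->
  (forall z, c <= f z <= C) -> (forall z, c <= g z <= C) ->
  (forall z, lam <= f z * g z) ->
  lam * expR (- (4 * eps ^+ 2)) <= (\int[P]_z f z) * (\int[P']_z g z).
Proof.
move=> PT P'T e0 lam0 c0 PP' P'P PeP' mf mg fC gC fg.
have Pfin : (P setT < +oo)%E by rewrite PT ltry.
have P'fin : (P' setT < +oo)%E by rewrite P'T ltry.
have intc Q (r : R) : Q setT = 1%E ->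
    \int[Q]_z r = r.
  by move=> QT; rewrite Rintegral_cst// QT mulr1.
have gc z : c <= g z by case/andP: (gC z).
have g_gt0 z : 0 < g z by exact: lt_le_trans (gc z).
have C0 : 0 < C.
  (* A space of mass one has a point, and there 0 < g <= C. *)
  have [z0 _] : (setT : set Z) !=set0.
    apply/set0P/negP => /eqP T0; move: PT; rewrite T0 measure0 => /eqP.
    by rewrite eqe eq_sym oner_eq0.
  have := gC z0; have := g_gt0 z0; lra.
have Hi Q h (K : R) : (Q setT < +oo)%E -> measurable_fun setT h ->
    (forall z, `|h z| <= K) -> Q.-integrable setT (EFin \o h).
  exact: bounded_integrable.
have ig Q : (Q setT < +oo)%E -> Q.-integrable setT (EFin \o g).
  by move=> Qf; apply: (Hi _ _ C) => // z; rewrite gtr0_norm//; case/andP: (gC z).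
have if_ : P.-integrable setT (EFin \o f).
  apply: (Hi _ _ C) => // z; case/andP: (fC z) => ? ?.
  by rewrite gtr0_norm//; lra.
pose h z := (g z)^-1.
have mh : measurable_fun setT h.
  rewrite (_ : h = (fun x => x `^ (- 1)) \o g).
    exact: measurableT_comp (measurable_powR _) mg.
  by apply/funext => z /=; rewrite powR_inv1// ltW.
have ih : P.-integrable setT (EFin \o h).
  apply: (Hi _ _ c^-1) => // z; rewrite gtr0_norm ?invr_gt0//.
  by rewrite lef_pV2 ?posrE.
set F := \int[P]_z f z; set G := \int[P']_z g z.
set a := \int[P]_z g z; set H := \int[P]_z h z.
have ca : c <= a.
  rewrite -(intc P c PT); apply: le_Rintegral => //; last exact: ig.
  exact: (Hi _ _ `|c|).
have a0 : 0 < a by lra.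
have aC : a <= C.
  rewrite -(intc P C PT); apply: le_Rintegral => //; first exact: ig.
    by apply: (Hi _ _ `|C|).
  by move=> z _; case/andP: (gC z).
(* The comparison of measures applies to nonnegative functions, so g - a is split into its positive
   and negative parts. *)
pose pos z : R := Num.max (g z - a) 0; pose neg z : R := Num.max (a - g z) 0.
have mpos : measurable_fun setT pos.
  by apply: measurable_maxr => //; exact: measurable_funB.
have mneg : measurable_fun setT neg.
  by apply: measurable_maxr => //; exact: measurable_funB.
have pos0C z : 0 <= pos z <= C.
  case/andP: (gC z) => ? ?; rewrite /pos le_max lexx orbT /= ge_max.
  by apply/andP; split; lra.
have neg0C z : 0 <= neg z <= C.
  rewrite /neg le_max lexx orbT /= ge_max.
  by apply/andP; split; have := g_gt0 z; lra.
have ipos Q : (Q setT < +oo)%E -> Q.-integrable setT (EFin \o pos).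
  by move=> Qf; apply: (Hi _ _ C) => // z; case/andP: (pos0C z) => ? ?; rewrite ger0_norm.
have ineg Q : (Q setT < +oo)%E -> Q.-integrable setT (EFin \o neg).
  by move=> Qf; apply: (Hi _ _ C) => // z; case/andP: (neg0C z) => ? ?; rewrite ger0_norm.
have icst Q (r : R) : (Q setT < +oo)%E -> Q.-integrable setT (EFin \o (fun=> r)).
  by move=> Qf; apply: (Hi _ _ `|r|).
have posneg z : g z + neg z = a + pos z.
  exact: addr_maxB0.
have balance Q : Q setT = 1%E ->
    \int[Q]_z g z + \int[Q]_z neg z = a + \int[Q]_z pos z.
  move=> QT; have Qf : (Q setT < +oo)%E by rewrite QT ltry.
  rewrite -RintegralD//; [|exact: ig|exact: ineg].
  under eq_Rintegral do rewrite posneg.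
  rewrite RintegralD//; [|exact: icst|exact: ipos].
  by rewrite intc.
(* With [hpos] and [hneg], the two balances give a - G <= eps times the P-mean of |g - a|. *)
have balP : a + \int[P]_z neg z = a + \int[P]_z pos z := balance P PT.
have balP' : G + \int[P']_z neg z = a + \int[P']_z pos z := balance P' P'T.
have hpos := @le_measure_Rintegral P P' P eps pos C Pfin P'fin Pfin e0 PP' mpos pos0C.
have hneg := @le_measure_Rintegral P' P P eps neg C P'fin Pfin Pfin e0 P'P mneg neg0C.
have hg : a <= G + eps * a.
  apply: (@le_measure_Rintegral P P' P eps g C) => // z.
  by case/andP: (gC z) => ? ->; rewrite ltW.
have hge : a <= expR 1 * G.
  have e1 : 0 <= expR 1 - 1 :> R by have := @expR_ge1Dx R 1; lra.
  have : a <= G + (expR 1 - 1) * G.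
    apply: (@le_measure_Rintegral P P' P' _ g C) => // [S mS|z]; last first.
      by case/andP: (gC z) => ? ->; rewrite ltW.
    rewrite (le_trans (PeP' _ mS))//.
    rewrite -[X in (_ <= X + _)%E](mul1e (P' S)) -ge0_muleDl ?lee_fin//.
    by rewrite -EFinD subrKC.
  lra.
(* AM-GM with weight g: eps |g - a| <= ((g - a)^2 / g + eps^2 g) / 2. The P-mean of (g - a)^2 / g is
   a (a H - 1) = a y, so the error is measured by the Jensen excess. *)
have amgm z : eps * (pos z + neg z) <=
    2^-1 * (g z + a ^+ 2 * h z) + (eps ^+ 2 / 2 * g z - a).
  have -> : pos z + neg z = `|g z - a|.
    exact: maxB0_norm.
  rewrite -subr_ge0.
  have -> : 2^-1 * (g z + a ^+ 2 * h z) + (eps ^+ 2 / 2 * g z - a) -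
     eps * `|g z - a| = (`|g z - a| - eps * g z) ^+ 2 / (2 * g z).
    have -> : (`|g z - a| - eps * g z) ^+ 2 =
       (g z - a) ^+ 2 - 2 * eps * g z * `|g z - a| + eps ^+ 2 * g z ^+ 2.
      by rewrite -[X in _ = X - _ + _]real_normK ?num_real//; ring.
    by rewrite /h; field; rewrite gt_eqF.
  by rewrite divr_ge0 ?sqr_ge0// mulr_ge0// ltW.
(* The tangent line of 1/g at a; integrated, it is Jensen's inequality a H >= 1, that is y >= 0. *)
have hsq z : 2 * a - g z <= a ^+ 2 * h z.
  rewrite -subr_ge0 (_ : _ - _ = (g z - a) ^+ 2 / g z).
    by rewrite divr_ge0 ?sqr_ge0// ltW.
  by rewrite /h; field; rewrite gt_eqF.
have iZ (r : R) u : P.-integrable setT (EFin \o u) ->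
    P.-integrable setT (EFin \o (fun z => r * u z)).
  by move=> iu; exact: (integrableZl measurableT r iu).
have iD u v : P.-integrable setT (EFin \o u) -> P.-integrable setT (EFin \o v) ->
    P.-integrable setT (EFin \o (fun z => u z + v z)).
  by move=> iu iv; exact: (integrableD measurableT iu iv).
have iB u v : P.-integrable setT (EFin \o u) -> P.-integrable setT (EFin \o v) ->
    P.-integrable setT (EFin \o (fun z => u z - v z)).
  by move=> iu iv; exact: (integrableB measurableT iu iv).
have igP := ig P Pfin; have ipP := ipos P Pfin; have inP := ineg P Pfin.
have iaP := icst P a Pfin; have i2aP := icst P (2 * a) Pfin.
have i2 := iZ (a ^+ 2) _ ih.
have i3 := iD _ _ igP i2.
have i4 := iZ (eps ^+ 2 / 2) _ igP.
have i5 := iB _ _ i4 iaP.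
have I1 : 2 * a - a <= a ^+ 2 * H.
  have <- : \int[P]_z (2 * a - g z) = 2 * a - a by rewrite RintegralB// intc.
  have <- : \int[P]_z (a ^+ 2 * h z) = a ^+ 2 * H by rewrite RintegralZl.
  by apply: le_Rintegral => //; exact: iB.
have I2 : eps * (\int[P]_z pos z + \int[P]_z neg z) <=
    2^-1 * (a + a ^+ 2 * H) + (eps ^+ 2 / 2 * a - a).
  have i1 := iD _ _ ipP inP.
  have i6 := iZ 2^-1 _ i3.
  have <- : \int[P]_z (eps * (pos z + neg z)) =
      eps * (\int[P]_z pos z + \int[P]_z neg z).
    by rewrite RintegralZl// RintegralD.
  have <- : \int[P]_z (2^-1 * (g z + a ^+ 2 * h z) + (eps ^+ 2 / 2 * g z - a)) =
      2^-1 * (a + a ^+ 2 * H) + (eps ^+ 2 / 2 * a - a).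
    rewrite RintegralD// RintegralZl// RintegralD// RintegralZl// RintegralB//.
    by rewrite RintegralZl// intc.
  by apply: le_Rintegral => //; [exact: iZ|exact: iD].
have I3 : lam * H <= F.
  rewrite -RintegralZl//; apply: le_Rintegral => //; first exact: iZ.
  by move=> z _; rewrite /h ler_pdivrMr.
have G0 : 0 <= G by apply: Rintegral_ge0 => z _; exact: ltW.
set y := a * H - 1.
have y0 : 0 <= y by rewrite /y -(pmulr_rge0 _ a0); lra.
have GA : a * (1 - y / 2 - eps ^+ 2 / 2) <= G.
  have -> : a * (1 - y / 2 - eps ^+ 2 / 2) =
    a - (2^-1 * (a + a ^+ 2 * H) + (eps ^+ 2 / 2 * a - a)) by rewrite /y; field.
  lra.
rewrite (le_trans _ (ler_wpM2r G0 I3))// -mulrA ler_wpM2l//.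
have -> : H = (1 + y) / a by rewrite /y; field; rewrite gt_eqF.
by apply: affinity_step_real => //; lra.
Qed.

End change_of_measure.

(** * The two-point laws on -1 and 1: support, mean and integrals *)

Section sign_law.
Context {R : realType}.
Implicit Types p : R.

Definition sign_of (b : bool) : R := if b then 1 else -1.

Lemma measurable_sign_of : measurable_fun setT sign_of.
Proof. by []. Qed.

HB.instance Definition _ :=
  isMeasurableFun.Build _ _ _ _ sign_of measurable_sign_of.

Definition sign_law p : probability R R :=
  distribution (bernoulli_prob p) sign_of.

Lemma supported_sign_law p : supported_in_unit (sign_law p).
Proof.
rewrite /supported_in_unit /= /distribution /pushforward.
rewrite (_ : _ @^-1` _ = setT) ?probability_setT//.
by apply/seteqP; split=> // -[] _ /=; rewrite in_itv/= /sign_of; lra.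
Qed.

Lemma mean_sign_law p : 0 <= p <= 1 -> mean_of (sign_law p) = 2 * p - 1.
Proof.
move=> p01; have fin : (bernoulli_prob p setT < +oo)%E by rewrite probability_setT ltry.
have int_sign : (bernoulli_prob p).-integrable setT (EFin \o sign_of).
  by apply: (@bounded_integrable _ _ _ _ _ 1) => // -[]; rewrite /sign_of ?normrN normr1.
have int1 (r : R) : (bernoulli_prob p).-integrable setT (EFin \o (fun=> r)).
  exact: (@bounded_integrable _ _ _ _ _ `|r|).
rewrite /mean_of /sign_law integral_distribution//.
rewrite -[LHS]/(\int[bernoulli_prob p]_b sign_of b).
(* The sign is shifted by 1 so that the Bernoulli integral formula meets a nonnegative integrand. *)
have -> : \int[bernoulli_prob p]_b sign_of b =
    \int[bernoulli_prob p]_b (sign_of b + 1) - 1.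
  rewrite RintegralD// (Rintegral_cst _ measurableT).
  by rewrite [fine _](congr1 fine (probability_setT (bernoulli_prob p))) mulr1 addrK.
congr (_ - _); rewrite /Rintegral integral_bernoulli_prob//=.
  by rewrite /sign_of addNr mulr0 addr0 mulrC.
by move=> []; rewrite lee_fin /sign_of; lra.
Qed.

(** The integral of an arbitrary nonnegative function is a supremum over the simple functions below
    it, so a larger function has more competitors. *)
Lemma ge0_le_integral_pointwise d (T : measurableType d)
    (mu : {measure set T -> \bar R}) (f1 f2 : T -> \bar R) :
  (forall x, 0 <= f1 x)%E -> (forall x, f1 x <= f2 x)%E ->
  (\int[mu]_x f1 x <= \int[mu]_x f2 x)%E.
Proof.
move=> f10 f12; have f20 x : (0 <= f2 x)%E by exact: le_trans (f12 x).
rewrite !ge0_integralTE//; apply: ge_ereal_sup => _ [h hf1 <-].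
apply: ereal_sup_ubound; exists h => // x; exact: le_trans (hf1 x) (f12 x).
Qed.

(** [f] is arbitrary off the two atoms, so it is bounded below by the measurable [f'], which agrees
    with it at 1 and -1 and vanishes elsewhere. *)
Lemma le_integral_sign_law p (f : R -> \bar R) : 0 <= p <= 1 ->
  (forall x, 0 <= f x)%E ->
  (p%:E * f 1%R + (1 - p)%:E * f (-1)%R <= \int[sign_law p]_x f x)%E.
Proof.
move=> p01 f0.
pose f' (x : R) : \bar R :=
    (f 1%R * (\1_[set 1%R] x)%:E + f (-1)%R * (\1_[set (-1)%R] x)%:E)%E.
have f'0 x : (0 <= f' x)%E by rewrite adde_ge0// mule_ge0// lee_fin.
have N11 : (-1 : R) != 1 by apply/eqP; lra.
have f'1 : f' 1 = f 1.
  by rewrite /f' !indicE mem_set// memNset/= ?mule1 ?mule0 ?adde0//; lra.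
have f'N1 : f' (-1) = f (-1).
  have n1 : ((-1 : R) \in [set 1%R]) = false by rewrite memNset//=; lra.
  by rewrite /f' !indicE n1 mem_set//= mule1 mule0 add0e.
apply: (@le_trans _ _ (\int[sign_law p]_x f' x)%E).
  rewrite ge0_integral_distribution//.
    by rewrite integral_bernoulli_prob/= ?f'1 ?f'N1// => x; exact: f'0.
  apply: emeasurable_funD; apply: measurable_funeM; apply/measurable_EFinP;
    exact: measurable_indic.
apply: ge0_le_integral_pointwise => // x.
have [->|x1] := eqVneq x 1; first by rewrite f'1.
have [->|xN1] := eqVneq x (-1); first by rewrite f'N1.
rewrite /f' !indicE !memNset/= ?mule0 ?adde0//; exact/eqP.
Qed.

End sign_law.

(** * Mixtures of measures over sign data of random size *)

Section mixture.
Context {R : realType} {d : measure_display} {Z : measurableType d}.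
Implicit Types (p q : {nonneg R}) (M : nat -> {nonneg R}) (k : nat)
  (m : seq R -> {measure set Z -> \bar R}) (S : set Z).

(** The analogue of [sign_sum] for measures, assembled from sums and scalings so that it is a
    measure by construction and integrals against it unfold. *)
Fixpoint sign_mix p q k m : {measure set Z -> \bar R} :=
  if k is k'.+1 then
    measure_add (mscale p (sign_mix p q k' (fun s => m (1 :: s))))
                (mscale q (sign_mix p q k' (fun s => m (-1 :: s))))
  else m [::].

(** If [m s] is the law of a view given the data s, this is the law of the view when the size is
    drawn from M and the data are i.i.d. signs. *)
Definition size_mix p q M m : {measure set Z -> \bar R} :=
  mseries (fun k => mscale (M k) (sign_mix p q k m)) 0.

Lemma sign_mixS p q k m S : sign_mix p q k.+1 m S =
  (p%:num%:E * sign_mix p q k (fun s => m (1%R :: s)) S +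
   q%:num%:E * sign_mix p q k (fun s => m (-1 :: s)%R) S)%E.
Proof. by rewrite [LHS]measure_addE. Qed.

Lemma sign_mixE p q k m S : (forall s, signs k s -> m s S \is a fin_num) ->
  sign_mix p q k m S =
  (sign_sum p%:num q%:num k (fun s => fine (m s S)))%:E.
Proof.
elim: k m => [|k IH] m mS; first by rewrite /= fineK// mS.
by rewrite sign_mixS !IH// => s /[dup] /signs_cons1 ? /signs_consN1 ?; exact: mS.
Qed.

Lemma size_mixE p q M m S : (forall s, m s S \is a fin_num) ->
  size_mix p q M m S = (\sum_(k <oo)
    ((M k)%:num * sign_sum p%:num q%:num k (fun s => fine (m s S)))%:E)%E.
Proof.
move=> mS; apply: eq_eseriesr => k _.
by rewrite EFinM -sign_mixE.
Qed.

Lemma measurable_sign_mix p q k d' (Y : measurableType d')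
    (m : Y -> seq R -> {measure set Z -> \bar R}) S :
  (forall s, signs k s -> measurable_fun setT (fun y => m y s S)) ->
  measurable_fun setT (fun y => sign_mix p q k (m y) S).
Proof.
elim: k m => [|k IH] m mm; first exact/mm/signs_nil.
under eq_fun do rewrite sign_mixS.
by apply: emeasurable_funD; apply: measurable_funeM;
  apply: (IH (fun y s => m y (_ :: s))) => s
    /[dup] /signs_cons1 ? /signs_consN1 ?; exact: mm.
Qed.

Lemma measurable_size_mix p q M d' (Y : measurableType d')
    (m : Y -> seq R -> {measure set Z -> \bar R}) S : (M 0%N)%:num = 0 ->
  (forall k s, (0 < k)%N -> signs k s -> measurable_fun setT (fun y => m y s S)) ->
  measurable_fun setT (fun y => size_mix p q M (m y) S).
Proof.
move=> M0 mm; apply: ge0_emeasurable_sum => [k y _ _|k _]; first exact: measure_ge0.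
(* Measurability is known for positive sizes; size 0 has weight 0. *)
case: k => [|k].
  rewrite (_ : (fun _ => _) = cst 0%E)//.
  by apply/funext => y; rewrite /= /mscale/= M0 mul0e.
apply: measurable_funeM; apply: measurable_sign_mix => s; exact: mm.
Qed.

Lemma iter_int_ge0 (mu : probability R R) k (g : seq R -> \bar R) :
  (forall s, 0 <= g s)%E -> (0 <= iter_int mu k g)%E.
Proof.
elim: k g => [|k IH] g g0 /=; first exact: g0.
by apply: integral_ge0 => x _; exact: IH.
Qed.

Lemma nu_int_ge0 M (mu : probability R R) (g : seq R -> \bar R) :
  (forall s, 0 <= g s)%E -> (0 <= nu_int (fun k => (M k)%:num) mu g)%E.
Proof.
move=> g0; apply: nneseries_ge0 => k _ _.
by rewrite mule_ge0 ?lee_fin// iter_int_ge0.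
Qed.

(** Each level of [iter_int] is bounded below by its two atoms through [le_integral_sign_law]. *)
Lemma le_sign_mix_iter_int p q k m (f : Z -> \bar R) (g : seq R -> \bar R) :
  p%:num + q%:num = 1 ->
  measurable_fun setT f -> (forall z, 0 <= f z)%E -> (forall s, 0 <= g s)%E ->
  (forall s, \int[m s]_z f z <= g s)%E ->
  (\int[sign_mix p q k m]_z f z <= iter_int (sign_law p%:num) k g)%E.
Proof.
move=> pq mf f0; elim: k m g => [|k IH] m g g0 mg; first exact: mg.
have qE : q%:num = 1 - p%:num by lra.
rewrite ge0_integral_measure_add// !ge0_integral_mscale//.
apply: le_trans (le_integral_sign_law _ _).
- rewrite -qE; apply: leeD; apply: lee_wpmul2l; rewrite ?lee_fin//;
    exact: IH.
- by have q0 : 0 <= q%:num by []; have p0 : 0 <= p%:num by []; lra.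
- by move=> x; exact: iter_int_ge0.
Qed.

Lemma le_size_mix_nu_int p q M m (f : Z -> \bar R) (g : seq R -> \bar R) :
  p%:num + q%:num = 1 ->
  measurable_fun setT f -> (forall z, 0 <= f z)%E -> (forall s, 0 <= g s)%E ->
  (forall s, \int[m s]_z f z <= g s)%E ->
  (\int[size_mix p q M m]_z f z <=
   nu_int (fun k => (M k)%:num) (sign_law p%:num) g)%E.
Proof.
move=> pq mf f0 g0 mg; rewrite ge0_integral_measure_series//.
apply: lee_nneseries => [k _ _|k _]; first exact: integral_ge0.
by rewrite ge0_integral_mscale// lee_wpmul2l ?lee_fin// le_sign_mix_iter_int.
Qed.

Lemma in_X1 : in_X [:: 1 : R].
Proof. by split=> // r; rewrite inE => /eqP->; lra. Qed.

(** An average with weights of sum one stays between the bounds; the empty sequence, which is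
    outside [in_X], has weight M 0 = 0. *)
Lemma size_mix_bound p q M m S (c1 c2 : R) : p%:num + q%:num = 1 ->
  (M 0%N)%:num = 0 -> (\sum_(k <oo) ((M k)%:num)%:E = 1)%E ->
  (forall s, m s S \is a fin_num) ->
  (forall s, in_X s -> c1 <= fine (m s S) <= c2) -> 0 <= c1 ->
  (c1%:E <= size_mix p q M m S <= c2%:E)%E.
Proof.
move=> pq M0 M1 mS mc c10.
have c20 : 0 <= c2 by have := mc _ in_X1; lra.
have cst (c : R) : 0 <= c -> c%:E = (\sum_(k <oo) ((M k)%:num * c)%:E)%E.
  move=> c0; rewrite -[LHS]mule1 -M1 -nneseriesZl ?lee_fin//.
  by apply: eq_eseriesr => k _; rewrite -EFinM mulrC.
rewrite size_mixE// (cst c1)// (cst c2)//.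
have bnd k : (0 < k)%N ->
    c1 <= sign_sum p%:num q%:num k (fun s => fine (m s S)) <= c2.
  move=> k0; apply/andP; split.
    rewrite -[leLHS](sign_sum_cst k c1 pq); apply: le_sign_sum => // s ks.
    by case/andP: (mc s (signs_in_X k0 ks)).
  rewrite -[leRHS](sign_sum_cst k c2 pq); apply: le_sign_sum => // s ks.
  by case/andP: (mc s (signs_in_X k0 ks)).
have sge0 k : 0 <= sign_sum p%:num q%:num k (fun s => fine (m s S)).
  rewrite -(sign_sum_cst k 0 pq); apply: le_sign_sum => // s _; exact: fine_ge0.
apply/andP; split; apply: lee_nneseries => [k _ _|k _];
  rewrite lee_fin ?mulr_ge0//; case: k => [|k]; rewrite ?M0 ?mul0r//;
  by rewrite ler_wpM2l//; case/andP: (bnd k.+1 isT).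
Qed.

End mixture.

(** * Comparison of the two laws of a private view *)

Section comparison.
Context {R : realType} {d : measure_display} {Z : measurableType d}.
Implicit Types (M : nat -> {nonneg R}) (m : seq R -> {measure set Z -> \bar R}).

(* Bounds the L1 distance of the laws of a user's data at signs of mean 0 and
   dl: sizes up to a contribute 3 dl sqrt k, larger ones at most 2. *)
Definition tv_bound (dl : R) (Mp : nat -> R) (a : nat) : R :=
  3 * dl * sqrt_trunc_mean Mp a + 2 * tailM Mp a.

Lemma tv_bound_ge0 dl Mp a : 0 <= dl -> (forall k, 0 <= Mp k) ->
  0 <= tv_bound dl Mp a.
Proof.
move=> dl0 Mp0; rewrite addr_ge0// mulr_ge0//; first by lra.
  by apply: sumr_ge0 => k _; rewrite mulr_ge0 ?sqrtr_ge0.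
by apply: fine_ge0; apply: nneseries_ge0 => k _ _; rewrite lee_fin.
Qed.

(** Averages over the size the distance bounds c sqrt k up to a and 2 beyond; c = 3 dl yields
    [tv_bound]. *)
Lemma truncated_series (Mp : nat -> R) (a : nat) (c : R) :
  is_distrib_Nstar Mp -> 0 <= c ->
  (\sum_(k <oo) (Mp k * (if (k <= a)%N then c * Num.sqrt k%:R else 2))%:E =
   (c * sqrt_trunc_mean Mp a + 2 * tailM Mp a)%:E)%E.
Proof.
move=> [Mge0 M0 M1] c0.
rewrite (@nneseries_split _ _ 0%N a.+1); last first.
  move=> k _; rewrite lee_fin mulr_ge0//; case: ifP => // _.
  by rewrite mulr_ge0// sqrtr_ge0.
rewrite add0n EFinD; congr (_ + _)%E.
  rewrite sumEFin; congr EFin.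
  rewrite big_ltn// M0 mul0r add0r /sqrt_trunc_mean big_distrr/=.
  rewrite big_nat_cond [RHS]big_nat_cond; apply: eq_bigr => k.
  by rewrite andbT => /andP[_ ka]; rewrite -ltnS ka; ring.
(* [tailM] is a [fine], so it represents the tail only once the tail is known to be finite. *)
have tail_fin : (\sum_(a.+1 <= k <oo) (Mp k)%:E)%E \is a fin_num.
  rewrite ge0_fin_numE; last by apply: nneseries_ge0 => k _ _; rewrite lee_fin.
  apply: (@le_lt_trans _ _ 1%E); last by rewrite ltry.
  rewrite -M1 [leRHS](@nneseries_split _ _ 0%N a.+1) ?add0n; last first.
    by move=> k _; rewrite lee_fin.
  by rewrite leeDr// sume_ge0// => k _; rewrite lee_fin.
rewrite EFinM /tailM fineK// -nneseriesZl; last by move=> k _; rewrite lee_fin.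
apply: congr_lim; apply/funext => N; apply: eq_big_nat => k /andP[ak _].
by rewrite leqNgt ak/= -EFinM mulrC.
Qed.

(** Let f0 be the mass of S given the reference data [[:: 1]]. Privacy keeps every mass within (K -
    1) f0 of f0, so the two mixtures differ by at most (K - 1) f0 T; the bound f0 <= K P0 makes this
    error relative to P0. *)
Lemma size_mix_compare (p q p' q' : {nonneg R}) M m S (K dl : R) (a : nat) :
  p%:num = 2^-1 -> q%:num = 2^-1 ->
  p'%:num = (1 + dl) / 2 -> q'%:num = (1 - dl) / 2 -> 0 <= dl <= 1 ->
  is_distrib_Nstar (fun k => (M k)%:num) -> 1 <= K ->
  (forall s, m s S \is a fin_num) ->
  (forall s s', in_X s -> in_X s' -> fine (m s S) <= K * fine (m s' S)) ->
  let T := tv_bound dl (fun k => (M k)%:num) a in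
  let P0 := size_mix p q M m S in let P1 := size_mix p' q' M m S in
  [/\ P0 <= P1 + (K * (K - 1) * T)%:E * P0,
      P1 <= P0 + (K * (K - 1) * T)%:E * P0 & P0 <= K%:E * P1]%E.
Proof.
move=> hp hq hp' hq' dl01 HM K1 mS mK T P0 P1.
have [_ M0 M1] := HM.
pose f s := fine (m s S); set f0 := f [:: 1].
have f_ge0 s : 0 <= f s by exact: fine_ge0.
have f00 : 0 <= f0 := f_ge0 _.
have pq : p%:num + q%:num = 1 by rewrite hp hq; lra.
have pq' : p'%:num + q'%:num = 1 by rewrite hp' hq'; lra.
have bnd1 p1 q1 s : p1%:num + q1%:num = 1 -> in_X s ->
    ((K^-1 * f s)%:E <= size_mix p1 q1 M m S <= (K * f s)%:E)%E.
  move=> pq1 sX; apply: size_mix_bound => //; last first.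
    by rewrite mulr_ge0// invr_ge0; lra.
  move=> s' s'X; rewrite mK// andbT ler_pdivrMl; last by lra.
  exact: mK.
have finP p1 q1 : p1%:num + q1%:num = 1 -> size_mix p1 q1 M m S \is a fin_num.
  move=> /bnd1/(_ in_X1)/andP[_ h]; rewrite ge0_fin_numE ?measure_ge0//.
  exact: le_lt_trans h (ltry _).
have T0 : 0 <= T by apply: tv_bound_ge0; [lra|case: HM].
have f0P0 : (((K - 1) * f0 * T)%:E <= (K * (K - 1) * T)%:E * P0)%E.
  have /andP[+ _] := bnd1 _ _ _ pq in_X1; rewrite -/P0 -/f0.
  rewrite /P0 -(fineK (finP _ _ pq)) -EFinM !lee_fin.
  set x := fine _ => h; have {}h : f0 <= K * x by rewrite -ler_pdivrMl//; lra.
  rewrite [leRHS](_ : _ = (K - 1) * (K * x) * T); last by ring.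
  by rewrite ler_wpM2r// ler_wpM2l//; lra.
have fdev k s : (0 < k)%N -> signs k s -> `|f s - f0| <= (K - 1) * f0.
  move=> k0 /(signs_in_X k0) sX.
  have h1 : f0 <= K * f s := mK _ _ in_X1 sX.
  have h2 : f s <= K * f0 := mK _ _ sX in_X1.
  rewrite ler_norml; apply/andP; split; last by lra.
  by have [fl|fl] := leP f0 (f s); nra.
pose t (k : nat) := if (k <= a)%N then 3 * dl * Num.sqrt k%:R else 2 : R.
have t0 k : 0 <= t k.
  by rewrite /t; case: ifP => // _; rewrite mulr_ge0 ?sqrtr_ge0//; lra.
have c0 : 0 <= (K - 1) * f0 by rewrite mulr_ge0//; lra.
have dev k : (0 < k)%N ->
    `|sign_sum p'%:num q'%:num k f - sign_sum p%:num q%:num k f| <=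
    (K - 1) * f0 * t k.
  move=> k0; rewrite hp hq hp' hq'.
  apply: (le_trans (@sign_sum_dist _ dl k f f0 _ dl01 c0 (fun s => @fdev k s k0))).
  rewrite ler_wpM2l// /t; case: ifP => _; last exact: sign_sum_density_dist2.
  by rewrite -mulrA; exact: sign_sum_density_dist.
have series (p1 q1 p2 q2 : {nonneg R}) :
    (forall k, (0 < k)%N -> sign_sum p1%:num q1%:num k f <=
       sign_sum p2%:num q2%:num k f + (K - 1) * f0 * t k) ->
    (size_mix p1 q1 M m S <= size_mix p2 q2 M m S + ((K - 1) * f0 * T)%:E)%E.
  move=> H; rewrite !size_mixE//.
  have s0 (p3 q3 : {nonneg R}) k : 0 <= sign_sum p3%:num q3%:num k f.
    rewrite -[leLHS](mul0r (sign_sum p3%:num q3%:num k f)) -sign_sumZ.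
    by apply: le_sign_sum => // s _; rewrite mul0r.
  rewrite EFinM -(@truncated_series (fun k => (M k)%:num) a (3 * dl))//; last by lra.
  rewrite -nneseriesZl; last by move=> k _; rewrite lee_fin mulr_ge0//; exact: t0.
  rewrite -nneseriesD; last 2 first.
    by move=> k _ _; rewrite lee_fin mulr_ge0.
    by move=> k _ _; rewrite lee_fin mulr_ge0// mulr_ge0//; exact: t0.
  apply: lee_nneseries => [k _ _|k _]; first by rewrite lee_fin mulr_ge0.
  rewrite -EFinM -EFinD lee_fin -/(t k).
  case: k => [|k]; first by rewrite M0 !mul0r mulr0 addr0.
  rewrite mulrCA -mulrDr ler_wpM2l//; exact: H.
split.
- apply: (le_trans (series p q p' q' _)); last by rewrite leeD2l.
  by move=> k /dev; rewrite ler_norml; lra.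
- apply: (le_trans (series p' q' p q _)); last by rewrite leeD2l.
  by move=> k /dev; rewrite ler_norml; lra.
- rewrite /P1 -(fineK (finP _ _ pq')) -EFinM.
  rewrite /P0 -(fineK (finP _ _ pq)) lee_fin.
  set x0 := fine _; set x1 := fine _.
  (* Each mass lies between x0 / K and K x0, and averaging under the second law preserves this. *)
  have : (((K^-1 * x0)%:E <= P1 <= (K * x0)%:E)%E).
    apply: size_mix_bound => //; last by rewrite mulr_ge0 ?fine_ge0// invr_ge0; lra.
    move=> s sX; have := bnd1 _ _ s pq sX.
    rewrite -(fineK (finP _ _ pq)) !lee_fin -/x0 => /andP[h1 h2].
    rewrite ler_pdivrMl ?h2/=; last by lra.
    by move: h1; rewrite ler_pdivrMl//; lra.
  rewrite /P1 -(fineK (finP _ _ pq')) !lee_fin -/x1 => /andP[+ _].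
  by rewrite ler_pdivrMl//; lra.
Qed.

End comparison.

(** * Sequential views: conditional risks, their measurability, and the induction over users *)

Section views.
Context {R : realType} {d : measure_display} {Z : measurableType d}.
Implicit Types (p q : {nonneg R}) (M : nat -> {nonneg R}) (Q : @mechanism R d Z)
  (l : seq Z -> R) (n r u : nat) (zs : seq Z).

Definition view_law p q M Q zs : {measure set Z -> \bar R} :=
  size_mix p q M (fun s => Q s zs).

(** The real-valued counterpart of [seq_expect] for sign data: the expected loss given the views zs
    when r users remain, with explicit mixtures in place of iterated integrals. *)
Fixpoint view_mean p q M Q l r zs : R :=
  if r is r'.+1 then
    \int[view_law p q M Q zs]_z view_mean p q M Q l r' (rcons zs z)
  else l zs.

Lemma view_law_setT p q M Q zs : p%:num + q%:num = 1 ->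
  is_distrib_Nstar (fun k => (M k)%:num) -> view_law p q M Q zs setT = 1%E.
Proof.
move=> pq [_ M0 M1]; have QT s : Q s zs setT = 1%E by rewrite probability_setT.
have := @size_mix_bound _ _ _ p q M (fun s => Q s zs) setT 1 1 pq M0 M1.
rewrite -eq_le => /(_ _ _ _)/eqP <-//= s; first by rewrite QT.
by rewrite QT /= lexx.
Qed.

Lemma measurable_in_unit_cube k u :
  measurable [set x : k.-tuple R * u.-tuple Z | forall i, -1 <= tnth x.1 i <= 1].
Proof.
(* The intersection may run over all j because [nth] returns the default 0, which lies in [-1, 1],
   beyond the last coordinate. *)
rewrite (_ : [set _ | _] = \bigcap_j
  [set x : k.-tuple R * u.-tuple Z | nth 0 x.1 j \in `[-1, 1]]); last first.
  apply/seteqP; split=> x /= xP.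
    move=> j _ /=; have [jk|kj] := ltnP j k; last first.
      by rewrite nth_default ?size_tuple// in_itv/=; lra.
    by have := xP (Ordinal jk); rewrite (tnth_nth 0) in_itv.
  by move=> i; have := xP i I; rewrite (tnth_nth 0)/= in_itv.
apply: bigcapT_measurable => j; have [jk|kj] := ltnP j k; last first.
  rewrite (_ : [set _ | _] = setT)//; apply/seteqP; split=> // x _ /=.
  by rewrite nth_default ?size_tuple// in_itv/=; lra.
have mt : measurable_fun setT (fun x : k.-tuple R * u.-tuple Z => tnth x.1 (Ordinal jk)).
  exact: measurableT_comp (measurable_tnth _) measurable_fst.
have := mt measurableT `[-1, 1]%classic (measurable_itv _); rewrite setTI.
by congr measurable; apply/seteqP; split=> x /=; rewrite (tnth_nth 0).
Qed.

(** The section at fixed data s of a jointly measurable map; signs lie in the cube where joint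
    measurability holds. *)
Lemma measurable_mech n Q k u (s : seq R) S : is_markov_mech n Q ->
  (0 < k)%N -> (u < n)%N -> signs k s -> measurable S ->
  measurable_fun setT (fun t : u.-tuple Z => Q s t S).
Proof.
move=> mQ k0 un [sk sP] mS.
have sk' : size s == k by rewrite sk.
have := mQ k u S k0 un mS.
set D := [set _ | _] => mD.
apply: (@measurable_comp _ _ _ _ _ _ D
  (fun x : k.-tuple R * u.-tuple Z => (Q (tval x.1) (tval x.2) S : \bar R))
  setT (fun t => (Tuple sk', t))) => //.
- exact: measurable_in_unit_cube.
- move=> _ [t _ <-] i /=; have /sP : tnth (Tuple sk') i \in s by exact: mem_tnth.
  by case=> ->; lra.
- exact: measurable_fun_pair.
Qed.

Lemma measurable_rcons u :
  measurable_fun setT (fun x : u.-tuple Z * Z => rcons_tuple x.1 x.2).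
Proof.
apply/measurable_fun_tnthP => i.
have [iu|ui] := ltnP i u.
  rewrite (_ : _ \o _ = (@tnth _ _ ^~ (Ordinal iu)) \o fst).
    exact: measurableT_comp (measurable_tnth _) measurable_fst.
  apply/funext => x /=; rewrite (tnth_nth x.2) [RHS](tnth_nth x.2)/=.
  by rewrite nth_rcons size_tuple iu.
rewrite (_ : _ \o _ = snd); first exact: measurable_snd.
apply/funext => x /=; rewrite (tnth_nth x.2)/= nth_rcons size_tuple ltnNge ui/=.
by rewrite if_same.
Qed.

Lemma view_mean_bound p q M Q l n r zs (C : R) : p%:num + q%:num = 1 ->
  is_distrib_Nstar (fun k => (M k)%:num) ->
  (forall t : n.-tuple Z, 0 <= l t <= C) -> (size zs + r)%N = n ->
  0 <= view_mean p q M Q l r zs <= C.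
Proof.
move=> pq HM lC; elim: r zs => [|r IH] zs zsr /=.
  have zsn : size zs == n by rewrite -zsr addn0.
  exact: lC (Tuple zsn).
have {}IH z : 0 <= view_mean p q M Q l r (rcons zs z) <= C.
  by apply: IH; rewrite size_rcons addSnnS.
rewrite Rintegral_ge0/=; last by move=> z _; case/andP: (IH z).
have h : (\int[view_law p q M Q zs]_z (view_mean p q M Q l r (rcons zs z))%:E <=
    C%:E)%E.
  apply: (@le_trans _ _ (\int[view_law p q M Q zs]_z C%:E)%E); last first.
    by rewrite integral_cst// view_law_setT// mule1.
  by apply: ge0_le_integral_pointwise => z; rewrite lee_fin; case/andP: (IH z).
rewrite -lee_fin fineK// ge0_fin_numE ?(le_lt_trans h) ?ltry//.
by apply: integral_ge0 => z _; rewrite lee_fin; case/andP: (IH z).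
Qed.

Lemma measurable_view_mean p q M Q l n r u (C : R) : p%:num + q%:num = 1 ->
  is_distrib_Nstar (fun k => (M k)%:num) -> is_markov_mech n Q ->
  measurable_fun setT (fun t : n.-tuple Z => l t) ->
  (forall t : n.-tuple Z, 0 <= l t <= C) -> (u + r)%N = n ->
  measurable_fun setT (fun t : u.-tuple Z => view_mean p q M Q l r t).
Proof.
move=> pq HM mQ ml lC; elim: r u => [|r IH] u ur.
  by move: ml; rewrite -ur addn0.
have un : (u < n)%N by rewrite -ur addnS ltnS leq_addr.
(* The law of the next view is packaged as a finite kernel, so that integrating a jointly measurable
   function against it is measurable in the past views. *)
pose K (t : u.-tuple Z) : {measure set Z -> \bar R} := view_law p q M Q t.
have mK S : measurable S -> measurable_fun setT (K ^~ S).
  move=> mS; apply: (@measurable_size_mix _ _ _ _ _ _ _ _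
    (fun (t : u.-tuple Z) s => Q s t)); first by case: HM.
  by move=> k s k0 ks; exact: measurable_mech mQ k0 un ks mS.
pose Kker := isKernel.Build _ _ _ _ _ K mK.
pose K1 : R.-ker _ ~> _ := HB.pack K Kker.
have Kuub : measure_fam_uub K1.
  (* The mass is 1 and the uniform bound has to be strict. *)
  by exists 2 => t /=; rewrite view_law_setT// lte_fin; lra.
pose Kfin := Kernel_isFinite.Build _ _ _ _ _ K1 Kuub.
pose K2 : R.-fker _ ~> _ := HB.pack (Kernel.sort K1) Kfin.
pose F (x : u.-tuple Z * Z) := (view_mean p q M Q l r (rcons_tuple x.1 x.2))%:E.
have F0 x : (0 <= F x)%E.
  case: x => t z; rewrite lee_fin.
  have szr : (size (rcons t z) + r)%N = n.
    by rewrite size_rcons size_tuple addSnnS.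
  by have /andP[] := view_mean_bound Q pq HM lC szr.
have mF : measurable_fun setT F.
  have mv := measurableT_comp (IH u.+1 (etrans (addSnnS _ _) ur))
    (@measurable_rcons u).
  exact: (measurableT_comp (@EFin_measurable _ _) mv).
have h := measurable_fun_integral_finite_kernel F K2 F0 mF.
exact: (measurableT_comp (fine_measurable measurableT) h).
Qed.

Lemma measurable_view_mean_rcons p q M Q l n r zs (C : R) :
  p%:num + q%:num = 1 ->
  is_distrib_Nstar (fun k => (M k)%:num) -> is_markov_mech n Q ->
  measurable_fun setT (fun t : n.-tuple Z => l t) ->
  (forall t : n.-tuple Z, 0 <= l t <= C) -> (size zs + r.+1)%N = n ->
  measurable_fun setT (fun z : Z => view_mean p q M Q l r (rcons zs z)).
Proof.
move=> pq HM mQ ml lC zsr.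
have mv := measurable_view_mean pq HM mQ ml lC (etrans (addSnnS _ _) zsr).
have mr : measurable_fun setT (fun z : Z => rcons_tuple (in_tuple zs) z).
  apply: (measurableT_comp (@measurable_rcons _)
    (g := fun z => (in_tuple zs, z))).
  exact: measurable_fun_pair.
exact: (measurableT_comp mv mr).
Qed.

Lemma seq_expect_ge0 M (mu : probability R R) Q (f : seq Z -> \bar R) r zs :
  (forall zs, 0 <= f zs)%E ->
  (0 <= seq_expect (fun k => (M k)%:num) mu Q f r zs)%E.
Proof.
move=> f0; elim: r zs => [|r IH] zs /=; first exact: f0.
by apply: nu_int_ge0 => s; apply: integral_ge0 => z _; exact: IH.
Qed.

(** Transfers lower bounds from the explicit mixtures to the true risk. One inequality is enough for
    this, and it avoids measurability of the conditional risk in the data. *)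
Lemma le_view_mean_seq_expect p q M Q l n r zs (C : R) :
  p%:num + q%:num = 1 ->
  is_distrib_Nstar (fun k => (M k)%:num) -> is_markov_mech n Q ->
  measurable_fun setT (fun t : n.-tuple Z => l t) ->
  (forall zs, 0 <= l zs) ->
  (forall t : n.-tuple Z, 0 <= l t <= C) -> (size zs + r)%N = n ->
  ((view_mean p q M Q l r zs)%:E <=
   seq_expect (fun k => (M k)%:num) (sign_law p%:num) Q (EFin \o l) r zs)%E.
Proof.
move=> pq HM mQ ml l0 lC; elim: r zs => [|r IH] zs zsr //=.
have zsr' z : (size (rcons zs z) + r)%N = n by rewrite size_rcons addSnnS.
have vb z := @view_mean_bound p q M Q l n r (rcons zs z) C pq HM lC (zsr' z).
have mv := @measurable_view_mean_rcons p q M Q l n r zs C pq HM mQ ml lC zsr.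
rewrite fineK; last first.
  apply: integrable_fin_num => //.
  apply: (@bounded_integrable _ _ _ _ _ C) => //.
    by rewrite view_law_setT// ltry.
  by move=> z; case/andP: (vb z) => v0 vC; rewrite ger0_norm.
apply: le_size_mix_nu_int => //.
- exact/measurable_EFinP.
- by move=> z; rewrite lee_fin; case/andP: (vb z).
- by move=> s; apply: integral_ge0 => z _; exact: seq_expect_ge0.
- move=> s; apply: ge0_le_integral_pointwise => z.
    by rewrite lee_fin; case/andP: (vb z).
  exact: IH.
Qed.

(** Induction on the remaining users: the induction hypothesis bounds the product of the conditional
    risks after one more view, and [affinity_step] integrates that view out at the cost of one
    exponential factor. *)
Lemma view_mean_product (p q p' q' : {nonneg R}) M Q n (K dl t lam C : R)
    (a : nat) l l' r zs :
  p%:num = 2^-1 -> q%:num = 2^-1 ->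
  p'%:num = (1 + dl) / 2 -> q'%:num = (1 - dl) / 2 -> 0 <= dl <= 1 ->
  is_distrib_Nstar (fun k => (M k)%:num) -> 1 <= K -> K <= expR 1 ->
  is_markov_mech n Q ->
  (forall zs s s' S, (size zs < n)%N -> in_X s -> in_X s' -> measurable S ->
    (Q s zs S <= K%:E * Q s' zs S)%E) ->
  measurable_fun setT (fun x : n.-tuple Z => l x) ->
  measurable_fun setT (fun x : n.-tuple Z => l' x) ->
  (forall x : n.-tuple Z, 0 <= l x <= C) ->
  (forall x : n.-tuple Z, 0 <= l' x <= C) ->
  0 < t -> 0 <= lam ->
  (forall x : n.-tuple Z, lam <= (l x + t) * (l' x + t)) ->
  (size zs + r)%N = n ->
  lam * expR (- (4 * (K * (K - 1) *
    tv_bound dl (fun k => (M k)%:num) a) ^+ 2)) ^+ r <=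
  (view_mean p q M Q l r zs + t) * (view_mean p' q' M Q l' r zs + t).
Proof.
move=> hp hq hp' hq' dl01 HM K1 Ke mQ LDP ml ml' lC lC' t0 lam0 ll' zsr0; set T := tv_bound _ _ _.
have pq : p%:num + q%:num = 1 by rewrite hp hq; lra.
have pq' : p'%:num + q'%:num = 1 by rewrite hp' hq'; lra.
elim: r zs zsr0 => [|r IH] zs zsr.
  have zsn : size zs == n by rewrite -zsr addn0.
  by rewrite expr0 mulr1; exact: ll' (Tuple zsn).
have zsr' z : (size (rcons zs z) + r)%N = n by rewrite size_rcons addSnnS.
have zsn : (size zs < n)%N by rewrite -zsr addnS ltnS leq_addr.
have vb z := @view_mean_bound p q M Q l n r (rcons zs z) C pq HM lC (zsr' z).
have vb' z := @view_mean_bound p' q' M Q l' n r (rcons zs z) C pq' HM lC' (zsr' z).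
have mv := @measurable_view_mean_rcons p q M Q l n r zs C pq HM mQ ml lC zsr.
have mv' := @measurable_view_mean_rcons p' q' M Q l' n r zs C pq' HM mQ ml' lC' zsr.
have PT := @view_law_setT p q M Q zs pq HM.
have PT' := @view_law_setT p' q' M Q zs pq' HM.
have addt (P : {measure set Z -> \bar R}) (v : Z -> R) : P setT = 1%E ->
    measurable_fun setT v -> (forall z, 0 <= v z <= C) ->
    \int[P]_z v z + t = \int[P]_z (v z + t).
  move=> P1 mv1 vC; have Pfin : (P setT < +oo)%E by rewrite P1 ltry.
  rewrite RintegralD//; first by rewrite Rintegral_cst// P1 mulr1.
    apply: (@bounded_integrable _ _ _ _ _ C) => // z.
    by case/andP: (vC z) => v0 vC'; rewrite ger0_norm.
  exact: (@bounded_integrable _ _ _ _ _ `|t|).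
have fin s S : measurable S -> Q s zs S \is a fin_num.
  by move=> mS; exact: fin_num_measure.
have ldp S s s' : measurable S -> in_X s -> in_X s' ->
    fine (Q s zs S) <= K * fine (Q s' zs S).
  by move=> mS sX s'X; rewrite -lee_fin EFinM !fineK ?fin//; exact: LDP.
have cmp S (mS : measurable S) := size_mix_compare a hp hq hp' hq' dl01 HM K1
  (fun s => fin s S mS) (fun s s' => ldp S s s' mS).
have T0 : 0 <= T by apply: tv_bound_ge0; [lra|case: HM].
rewrite exprSr mulrA /= !addt//.
(* The shift t provides the positive lower bound required of both functions. *)
apply: (@affinity_step _ _ _ _ _ _ _ t (C + t)) => //.
- by rewrite mulr_ge0// mulr_ge0//; lra.
- by rewrite mulr_ge0// exprn_ge0// expR_ge0.
- by move=> S mS; case: (cmp S mS).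
- by move=> S mS; case: (cmp S mS).
- move=> S mS; case: (cmp S mS) => _ _ /le_trans; apply.
  by rewrite lee_wpmul2r// lee_fin.
- exact: measurable_funD.
- exact: measurable_funD.
- by move=> z; have := vb z; lra.
- by move=> z; have := vb' z; lra.
- by move=> z; exact: IH.
Qed.

End views.

(** * Numerical constants and conclusion of the two-point argument *)

Lemma tv_bound_exponent (R : realType) : exists2 c : R, 0 < c &
  forall (Mp : nat -> R) (n a : nat) (alpha dl : R),
  0 < alpha -> alpha <= 22 / 35 -> 0 <= dl -> (forall k, 0 <= Mp k) ->
  n%:R * alpha ^+ 2 * sqrt_trunc_mean Mp a ^+ 2 * dl ^+ 2 <= 1 ->
  4 * (expR alpha * (expR alpha - 1) * tv_bound dl Mp a) ^+ 2 * n%:R <=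
  c + c * n%:R * alpha ^+ 2 * tailM Mp a ^+ 2.
Proof.
(* 5832 = 4 * 81 * 18: the factor 4 of the exponent, 9^2 from K (K - 1) <= 9 alpha, and 18 from
   [h2]. *)
exists 5832; first by rewrite ltr0n.
move=> Mp n a alpha dl a0 a1 dl0 Mp0 hdl.
have T0 := tv_bound_ge0 a dl0 Mp0.
have K1 : 1 <= expR alpha by have := expR_ge1Dx alpha; lra.
(* The range of alpha enters here through 3 alpha <= 2. *)
have K2 : expR alpha <= 1 + 3 * alpha by apply: expR_le1D; lra.
set K := expR alpha in K1 K2 *; set T := tv_bound dl Mp a in T0 *.
set E := sqrt_trunc_mean Mp a in hdl *; set P := tailM Mp a.
have KK : K * (K - 1) <= 9 * alpha by nra.
have KK0 : 0 <= K * (K - 1) by nra.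
have h1 : (K * (K - 1) * T) ^+ 2 <= 81 * alpha ^+ 2 * T ^+ 2.
  have -> : 81 * alpha ^+ 2 * T ^+ 2 = (9 * alpha * T) ^+ 2 by ring.
  by rewrite lerXn2r ?nnegrE ?mulr_ge0// ?ler_wpM2r//; lra.
have h2 : T ^+ 2 <= 18 * (dl ^+ 2 * E ^+ 2 + P ^+ 2).
  rewrite -subr_ge0.
  have -> : 18 * (dl ^+ 2 * E ^+ 2 + P ^+ 2) - T ^+ 2 =
    (3 * dl * E - 2 * P) ^+ 2 + 10 * P ^+ 2 by rewrite /T /tv_bound -/E -/P; ring.
  have s1 := sqr_ge0 (3 * dl * E - 2 * P); have s2 := sqr_ge0 P; lra.
have n0 : 0 <= n%:R * alpha ^+ 2 :> R by rewrite mulr_ge0 ?sqr_ge0.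
have h3 : (K * (K - 1) * T) ^+ 2 * n%:R <= 81 * (n%:R * alpha ^+ 2 * T ^+ 2).
  rewrite [leRHS](_ : _ = 81 * alpha ^+ 2 * T ^+ 2 * n%:R); last by ring.
  exact: ler_wpM2r.
have h4 := ler_wpM2l n0 h2.
lra.
Qed.

Theorem theorem1 (R : realType) :
  exists c1 c2 : R, 0 < c1 /\ 0 < c2 /\
  forall (n : nat) (alpha : R) (Mp : nat -> R),
    (0 < n)%N -> 0 < alpha -> alpha <= 22%:R / 35%:R ->
    is_distrib_Nstar Mp -> finite_mean Mp ->
    forall a : nat,
    forall (d : measure_display) (Z : measurableType d)
           (Q : @mechanism R d Z) (th : seq Z -> R),
      is_markov_mech n Q -> is_LDP n alpha Q -> is_estimator n th ->
      (((c1 * expR (- (c2 * n%:R * alpha ^+ 2 * (tailM Mp a) ^+ 2)))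
         / Num.max (n%:R * alpha ^+ 2 * (sqrt_trunc_mean Mp a) ^+ 2) 1)%:E
      <= worst_risk n Mp Q th)%E.
Proof.
have [c c0 hc] := tv_bound_exponent R.
(* exp(-c) pays for the constant part of the exponent, and 16 comes from the choice of t below. *)
exists (expR (- c) / 16), c.
split; first by rewrite divr_gt0 ?expR_gt0.
split=> // n alpha Mp _ a0 a1 HM _ a d Z Q th mQ ldp [mth thb].
have [Mp0 _ _] := HM.
set X := Num.max _ 1.
have X1 : 1 <= X by rewrite le_max lexx orbT.
(* The largest separation with dl <= 1 and n alpha^2 E[sqrt m; m <= a]^2 dl^2 <= 1. *)
pose dl := (Num.sqrt X)^-1.
have dl2 : dl ^+ 2 = X^-1 by rewrite exprVn sqr_sqrtr//; lra.
have dl_gt0 : 0 < dl by rewrite invr_gt0 sqrtr_gt0; lra.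
have dl01 : 0 <= dl <= 1.
  rewrite ltW//= invf_le1 ?sqrtr_gt0; last by lra.
  by rewrite -[leLHS]sqrtr1 ler_sqrt//; lra.
have hdl : n%:R * alpha ^+ 2 * sqrt_trunc_mean Mp a ^+ 2 * dl ^+ 2 <= 1.
  by rewrite dl2 ler_pdivrMr ?mul1r ?le_max ?lexx//; lra.
have p0 : 0 <= 2^-1 :> R by [].
have p1 : 0 <= (1 + dl) / 2 by lra.
have q1 : 0 <= (1 - dl) / 2 by lra.
pose M k := NngNum (Mp0 k).
have K1 : 1 <= expR alpha by have := expR_ge1Dx alpha; lra.
have Ke : expR alpha <= expR 1 by rewrite ler_expR; lra.
pose eta := expR (- (c + c * n%:R * alpha ^+ 2 * tailM Mp a ^+ 2)).
have eta0 : 0 < eta by exact: expR_gt0.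
(* The positive solution of t (dl^2 / 4) eta = (2 t)^2. *)
pose t := dl ^+ 2 * eta / 16.
have t0 : 0 < t by rewrite divr_gt0// mulr_gt0// exprn_gt0.
have -> : expR (- c) / 16 *
    expR (- (c * n%:R * alpha ^+ 2 * tailM Mp a ^+ 2)) / X = t.
  by rewrite /t /eta dl2 opprD expRD; ring.
pose l (m : R) zs := (th zs - m) ^+ 2.
have lb m (x : n.-tuple Z) : -1 <= m <= 1 -> 0 <= l m x <= 4.
  by move=> m1; have := thb x; rewrite /l sqr_ge0/=; nra.
have ml m : measurable_fun setT (fun x : n.-tuple Z => l m x).
  by apply: measurable_funX; exact: measurable_funB.
have m0E : mean_of (sign_law (2^-1 : R)) = 0 by rewrite mean_sign_law; lra.
have m1E : mean_of (sign_law ((1 + dl) / 2)) = dl by rewrite mean_sign_law; lra.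
have b0 (x : n.-tuple Z) : 0 <= l 0 x <= 4 by apply: lb; lra.
have b1 (x : n.-tuple Z) : 0 <= l dl x <= 4 by apply: lb; lra.
(* The estimate is at distance at least dl / 2 from one of the two means; the other shifted loss is
   at least t. *)
have lam (x : n.-tuple Z) : t * (dl ^+ 2 / 4) <= (l 0 x + t) * (l dl x + t).
  have := b0 x; have := b1 x; rewrite /l subr0; set y := th _ => ly1 ly0.
  have [yd|yd] := leP y (dl / 2).
    have : dl ^+ 2 / 4 <= (y - dl) ^+ 2 + t by nra.
    by move=> h; apply: ler_pM => //; [exact: ltW|rewrite divr_ge0 ?sqr_ge0|lra].
  have : dl ^+ 2 / 4 <= y ^+ 2 + t by nra.
  move=> h; rewrite mulrC.
  by apply: ler_pM => //; [rewrite divr_ge0 ?sqr_ge0|exact: ltW|lra].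
have tlam : 0 <= t * (dl ^+ 2 / 4).
  by apply: mulr_ge0; [exact: ltW|rewrite divr_ge0 ?sqr_ge0].
have prod := @view_mean_product R d Z (NngNum p0) (NngNum p0) (NngNum p1)
  (NngNum q1) M Q n (expR alpha) dl t _ 4 a (l 0) (l dl) n [::]
  erefl erefl erefl erefl dl01 HM K1 Ke mQ
  (fun zs s s' S zn sX sX' mS => ldp zs s s' S zn sX sX' mS)
  (ml 0) (ml dl) b0 b1 t0 tlam lam erefl.
have etale : eta <= expR (- (4 * (expR alpha * (expR alpha - 1) *
    tv_bound dl Mp a) ^+ 2)) ^+ n.
  rewrite -expRM_natr ler_expR mulNr lerN2.
  by apply: hc => //; lra.
have {etale}prod := le_trans (ler_wpM2l tlam etale) prod.
have risk_ge p (q : {nonneg R}) m : p%:num + q%:num = 1 ->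
    mean_of (sign_law p%:num) = m -> -1 <= m <= 1 ->
    ((view_mean p q M Q (l m) n [::])%:E <= worst_risk n Mp Q th)%E.
  move=> pq mE m1; apply: (@le_trans _ _ (risk n Mp Q th (sign_law p%:num))).
    rewrite /risk mE; apply: (@le_view_mean_seq_expect _ _ _ p q M Q (l m) n n
      [::] 4) => //; first by move=> zs; exact: sqr_ge0.
    by move=> x; exact: lb.
  by apply: ereal_sup_ubound; exists (sign_law p%:num) => //; exact: supported_sign_law.
have r0 := @risk_ge (NngNum p0) (NngNum p0) 0.
have r1 := @risk_ge (NngNum p1) (NngNum q1) dl.
set v0 := view_mean _ _ _ _ _ _ _ in prod; set v1 := view_mean _ _ _ _ _ _ _ in prod.
(* If both risks were below t, the product of the shifted risks would be below (2 t)^2, which is the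
   lower bound [prod]. *)
have [v0t|v0t] := leP t v0.
  apply: (@le_trans _ _ v0%:E); first by rewrite lee_fin.
  by apply: r0 => //=; lra.
have [v1t|v1t] := leP t v1.
  apply: (@le_trans _ _ v1%:E); first by rewrite lee_fin.
  by apply: r1 => //=; lra.
have v0_ge0 : 0 <= v0.
  by have /andP[] := @view_mean_bound _ _ _ (NngNum p0) (NngNum p0) M Q (l 0) n n [::] 4
    ltac:(rewrite /=; lra) HM b0 erefl.
have v1_ge0 : 0 <= v1.
  by have /andP[] := @view_mean_bound _ _ _ (NngNum p1) (NngNum q1) M Q (l dl) n n [::] 4
    ltac:(rewrite /=; lra) HM b1 erefl.
have vt v : 0 <= v -> 0 <= v + t by move=> v_ge0; rewrite addr_ge0// ltW.
have lt_t2 : (v0 + t) * (v1 + t) < (t + t) * (t + t).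
  by apply: ltr_pM; rewrite ?ltrD2r//; exact: vt.
have := le_lt_trans prod lt_t2.
by rewrite (_ : t * _ * _ = (t + t) * (t + t)) ?ltxx//; rewrite /t; field.
Qed.
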